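(* Let $R$ be a commutative ring, $n\ge2$, and let $\varphi$ be a $2n\times2n$ alternating matrix over $R$ with Pfaffian $1$. Let $\theta(X)\in{\rm SL}_{2n-1}(R[X])$ with $\theta(0)=I_{2n-1}$. If for every maximal ideal $\mathfrak m$ of $R$ the image $\theta(X)_{\mathfrak m}$ of $\theta(X)$ over $R_{\mathfrak m}[X]$ lies in ${\rm E}_{\varphi\otimes R_{\mathfrak m}[X]}(R_{\mathfrak m}[X])$, then $\theta(X)\in{\rm E}_{\varphi\otimes R[X]}(R[X])$.
   Context: All rings are commutative with identity; $R_{\mathfrak m}$ is the localisation at $\mathfrak m$. A square matrix is alternating if it is of the form $\nu-\nu^t$; alternating matrices of Pfaffian $1$ are invertible. Elements of $S^m$ are row vectors, ${}^t$ is transpose. For an invertible alternating $2n\times2n$ matrix $\varphi$ over a ring $S$ write $\varphi=\begin{pmatrix}0&-c\\ c^t&\nu\end{pmatrix}$, $\varphi^{-1}=\begin{pmatrix}0&d\\ -d^t&\mu\end{pmatrix}$ with $c,d\in S^{2n-1}$, and set $\alpha_\varphi(v)=I_{2n-1}+d^tv\nu$, $\beta_\varphi(v)=I_{2n-1}+\mu v^tc$ for $v\in S^{2n-1}$; ${\rm E}_\varphi(S)$ is the subgroup of ${\rm GL}_{2n-1}(S)$ generated by all these. For a ring homomorphism $R\to S$, ${\rm E}_{\varphi\otimes S}(S)$ denotes ${\rm E}_{\varphi'}(S)$ where $\varphi'$ is the image of $\varphi$ over $S$. *)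

(* Defs.v *)
From HB Require Import structures.
From mathcomp Require Import all_boot all_order all_algebra.
Set Implicit Arguments. Unset Strict Implicit. Unset Printing Implicit Defensive.
Import GRing.Theory.
Local Open Scope ring_scope.

(* Pfaffian, by the standard expansion along the first row:
   Pf(A) = sum_{j>=2} (-1)^j a_{1j} Pf(A with rows/cols 1,j removed)
   (1-based); Pf of the empty matrix is 1, of odd size is 0. *)
Fixpoint pfaffian (S : comNzRingType) (k : nat) : 'M[S]_k -> S :=
  match k return 'M[S]_k -> S with
  | 0 => fun _ => 1
  | 1 => fun _ => 0
  | k'.+2 => fun A =>
      \sum_(j < k'.+1)
        (-1) ^+ j * A ord0 (lift ord0 j) *
        pfaffian (\matrix_(a < k', b < k')
                    A (lift ord0 (lift j a)) (lift ord0 (lift j b)))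
  end.

Definition alternating (S : comNzRingType) (k : nat) (A : 'M[S]_k) : Prop :=
  exists nu : 'M[S]_k, A = nu - nu^T.

Section Elem.
Variables (S : comNzRingType) (k : nat).

(* phi = [[0, -c], [c^t, nu]],  phi^{-1} = psi = [[0, d], [-d^t, mu]] *)
Definition cvec (phi : 'M[S]_k.+1) : 'rV[S]_k := - \row_j phi ord0 (lift ord0 j).
Definition nublk (phi : 'M[S]_k.+1) : 'M[S]_k :=
  \matrix_(i, j) phi (lift ord0 i) (lift ord0 j).
Definition dvec (psi : 'M[S]_k.+1) : 'rV[S]_k := \row_j psi ord0 (lift ord0 j).
Definition mublk (psi : 'M[S]_k.+1) : 'M[S]_k :=
  \matrix_(i, j) psi (lift ord0 i) (lift ord0 j).

Definition alphaE (phi psi : 'M[S]_k.+1) (v : 'rV[S]_k) : 'M[S]_k :=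
  1%:M + (dvec psi)^T *m v *m nublk phi.
Definition betaE (phi psi : 'M[S]_k.+1) (v : 'rV[S]_k) : 'M[S]_k :=
  1%:M + mublk psi *m v^T *m cvec phi.

Definition E_gen (phi psi : 'M[S]_k.+1) (g : 'M[S]_k) : Prop :=
  exists v, g = alphaE phi psi v \/ g = betaE phi psi v.

Inductive inEphi (phi psi : 'M[S]_k.+1) : 'M[S]_k -> Prop :=
| inEphi_one : inEphi phi psi 1%:M
| inEphi_gen g M : E_gen phi psi g -> inEphi phi psi M -> inEphi phi psi (g *m M)
| inEphi_inv g h M : E_gen phi psi g -> g *m h = 1%:M ->
    inEphi phi psi M -> inEphi phi psi (h *m M).
End Elem.
Arguments inEphi {S k} phi psi _.

Definition is_ideal (R : comNzRingType) (I : R -> Prop) : Prop :=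
  I 0 /\ (forall x y, I x -> I y -> I (x + y)) /\ (forall a x, I x -> I (a * x)).

Definition maximal_ideal (R : comNzRingType) (m : R -> Prop) : Prop :=
  is_ideal m /\ ~ m 1 /\
  forall I : R -> Prop, is_ideal I -> (forall x, m x -> I x) ->
    (forall x, I x -> m x) \/ I 1.

Definition is_localization (R S : comNzRingType) (m : R -> Prop)
    (f : {rmorphism R -> S}) : Prop :=
  (forall s, ~ m s -> exists t, f s * t = 1) /\
  (forall x : S, exists a s, ~ m s /\ x * f s = f a) /\
  (forall a, f a = 0 -> exists s, ~ m s /\ s * a = 0).

(* Main.v *)
Require Import Defs.
From HB Require Import structures.
From mathcomp Require Import all_boot all_order all_algebra ring.
From mathcomp Require Import boolp classical_sets.
Set Implicit Arguments. Unset Strict Implicit. Unset Printing Implicit Defensive.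
Import GRing.Theory.
Local Open Scope ring_scope.

(** The relation phi psi = 1 says that c d^t = 1 and d^t c + mu nu = 1, so the
    rows v nu are exactly those killing d^t and the columns mu v^t exactly those
    killed by c.  Hence E_phi is the group generated by the transvections
    1 + d^t u (u d^t = 0) and 1 + w c (c w = 0).

    The key fact, valid without denominators, is that 1 + a s t p q lies in this
    group whenever q p = 0, some z satisfies q z = t or z p = t, and
    s = mu_ij^3 nu_kl^3.  Modulo a maximal ideal m the matrices mu and nu do not
    vanish since 1 has rank at least 2, so s may be chosen outside m.

    If theta is a product of such transvections over R_m[X], then
    theta(X+Y) theta(X)^-1 is a product of conjugates 1 + Y p q of transvections
    with p or q unimodular; substituting rY for Y with r outside m clears the
    denominators, and a second such substitution kills the kernel of
    localisation.  So the s in R for which theta(X+sY) theta(X)^-1 is elementary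
    over R[X][Y] form an ideal contained in no maximal ideal; take s = 1 and
    substitute X = 0. *)

(** * Transvections *)

Section Transvections.
Variables (A : comNzRingType) (m : nat).
Implicit Types (c q u v es : 'rV[A]_m) (d e p w x y z : 'cV[A]_m) (M N : 'M[A]_m).

Definition tv x q : 'M[A]_m := 1%:M + x *m q.

(** Closed under inverses without a constructor for them: when [u d = 0] the inverse of [1 + d u] is
    [1 - d u], again a generator, and likewise for [1 + w c]. *)
Inductive Etr c d : 'M[A]_m -> Prop :=
| Etr_one : Etr c d 1%:M
| Etr_row u M : u *m d = 0 -> Etr c d M -> Etr c d (tv d u *m M)
| Etr_col w M : c *m w = 0 -> Etr c d M -> Etr c d (tv w c *m M).

Lemma mul_tv x q y v : q *m y = 0 -> tv x q *m tv y v = 1%:M + x *m q + y *m v.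
Proof.
move=> qy; rewrite /tv mulmxDr mulmx1 mulmxDl mul1mx.
by rewrite -mulmxA [q *m _]mulmxA qy mul0mx mulmx0 addr0.
Qed.

Lemma mul_tv_col x y q : q *m y = 0 -> tv x q *m tv y q = tv (x + y) q.
Proof. by move=> qy; rewrite mul_tv // /tv mulmxDl addrA. Qed.

Lemma mul_tv_row x q v : q *m x = 0 -> tv x q *m tv x v = tv x (q + v).
Proof. by move=> qy; rewrite mul_tv // /tv mulmxDr addrA. Qed.

Lemma tvN x q : q *m x = 0 -> tv x q *m tv (- x) q = 1%:M.
Proof.
by move=> qx; rewrite mul_tv_col ?mulmxN ?qx ?oppr0 // subrr /tv mul0mx addr0.
Qed.

Lemma tvZ a x q : tv (a *: x) q = tv x (a *: q).
Proof. by rewrite /tv -scalemxAl scalemxAr. Qed.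

(** A Steinberg-type commutator: on multiplying out, the three vanishing products kill every cross
    term but [x (u y) v]. *)
Lemma commutator_tv x u y v r :
  u *m x = 0 -> v *m y = 0 -> v *m x = 0 -> u *m y = r%:M ->
  tv x u *m tv y v *m (tv (- x) u *m tv (- y) v) = tv (r *: x) v.
Proof.
move=> ux vy vx uy.
rewrite -mulmxA [tv y v *m _]mulmxA.
have -> : tv y v *m tv (- x) u = tv (- x) u + y *m v.
  by rewrite mul_tv ?mulmxN ?vx ?oppr0 // /tv addrAC.
rewrite [(_ + y *m v) *m _]mulmxDl mulmxDr [tv x u *m (tv _ _ *m _)]mulmxA tvN // mul1mx.
have -> : y *m v *m tv (- y) v = y *m v.
  by rewrite /tv mulmxDr mulmx1 mulNmx mulmxN mulmxA -(mulmxA y) vy mulmx0 mul0mx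
             oppr0 addr0.
rewrite {2}/tv mulmxDl mul1mx mulmxA -(mulmxA x) uy mul_mx_scalar.
by rewrite /tv mulNmx addrA subrK.
Qed.

Section Group.
Variables (c : 'rV[A]_m) (d : 'cV[A]_m).

Lemma EtrM M N : Etr c d M -> Etr c d N -> Etr c d (M *m N).
Proof.
move=> EM EN; elim: EM => [|u M' ud _ IH|w M' cw _ IH]; first by rewrite mul1mx.
  by rewrite -mulmxA; apply: Etr_row.
by rewrite -mulmxA; apply: Etr_col.
Qed.

Lemma Etr_tv_row u : u *m d = 0 -> Etr c d (tv d u).
Proof. by move=> ud; rewrite -[tv d u]mulmx1; apply: Etr_row => //; constructor. Qed.

Lemma Etr_tv_col w : c *m w = 0 -> Etr c d (tv w c).
Proof. by move=> cw; rewrite -[tv w c]mulmx1; apply: Etr_col => //; constructor. Qed.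

Hypothesis cd : c *m d = 1%:M.

(** As [c d = 1], this is the commutator of the generators [1 + x c] and [1 + d u]. *)
Lemma Etr_tv_ker x u :
  c *m x = 0 -> u *m d = 0 -> u *m x = 0 -> Etr c d (tv x u).
Proof.
move=> cx ud ux; rewrite -[x]scale1r -(@commutator_tv x c d u) //.
have -> : tv (- d) u = tv d (- u) by rewrite /tv mulNmx mulmxN.
apply: EtrM; apply: EtrM; do ?[apply: Etr_tv_col|apply: Etr_tv_row] => //.
  by rewrite mulmxN cx oppr0.
by rewrite mulNmx ud oppr0.
Qed.

(** Subtracting [(q d) c] from [q] leaves a row that kills [d], and the part removed gives a column
    generator. *)
Lemma Etr_tv_col_ker x q : c *m x = 0 -> q *m x = 0 -> Etr c d (tv x q).
Proof.
move=> cx qx; pose a := (q *m d) 0 0.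
have qd : q *m d = a%:M by apply: mx11_scalar.
have -> : q = a *: c + (q - a *: c) by rewrite addrC subrK.
rewrite -mul_tv_row; last by rewrite -scalemxAl cx scaler0.
apply: EtrM; first by rewrite -tvZ; apply: Etr_tv_col; rewrite -scalemxAr cx scaler0.
apply: Etr_tv_ker => //.
  by rewrite mulmxBl -scalemxAl cd qd scalemx1 subrr.
by rewrite mulmxBl -scalemxAl cx qx scaler0 subr0.
Qed.

(** Up to sign, the contraction of the bivector of [x] and [y] by [q]: a Koszul relation, killed by
    [q]. *)
Definition wedge q x y : 'cV[A]_m := (q *m y) 0 0 *: x - (q *m x) 0 0 *: y.

Lemma mul_wedge q x y : q *m wedge q x y = 0.
Proof.
rewrite mulmxBr -!scalemxAr [q *m x]mx11_scalar [q *m y]mx11_scalar.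
by rewrite !mxE /= !mulr1n !scale_scalar_mx mulrC subrr.
Qed.

(* The vector e and the covector es play the role of a third coordinate, away
   from d and w, that makes the plane transvection a commutator. *)
Lemma Etr_wedge_partner q w e es r a :
  c *m w = 0 -> c *m e = 0 -> es *m d = 0 -> es *m w = 0 -> es *m e = r%:M ->
  Etr c d (tv ((a * r ^+ 2) *: wedge q d w) q).
Proof.
move=> cw ce esd esw ese; set x := wedge q d w.
have qx : q *m x = 0 by apply: mul_wedge.
have esx : es *m x = 0 by rewrite mulmxBr -!scalemxAr esd esw !scaler0 subrr.
(* [x] is a combination of [d] and [w], both killed by [es]: the [d] part gives a row generator, the
   [w] part falls under [Etr_tv_ker]. *)
have Exes b : Etr c d (tv (b *: x) es).
  have -> : b *: x = (b * (q *m w) 0 0) *: d + - (b * (q *m d) 0 0) *: w.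
    by rewrite /x /wedge scalerBr !scalerA scaleNr.
  rewrite -mul_tv_col; last by rewrite -scalemxAr esw scaler0.
  apply: EtrM; first by rewrite tvZ; apply: Etr_tv_row; rewrite -scalemxAl esd scaler0.
  by apply: Etr_tv_ker; rewrite // -scalemxAr ?cw ?esw scaler0.
pose b := (q *m e) 0 0; have qe : q *m e = b%:M by apply: mx11_scalar.
(* [y] is [r q] corrected to kill [e]. One factor [r] is spent on [r q = b es + y], the other on the
   commutator of [1 + a x es] and [1 + e y], where [es e = r]. *)
pose y := r *: q - b *: es.
have ye : y *m e = 0.
  by rewrite mulmxBl -!scalemxAl qe ese !scale_scalar_mx mulrC subrr.
have yx : y *m x = 0 by rewrite mulmxBl -!scalemxAl qx esx !scaler0 subrr.
have -> : tv ((a * r ^+ 2) *: x) q = tv ((a * r) *: x) (b *: es + y).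
  by rewrite addrC subrK -tvZ scalerA; congr (tv (_ *: _) _); ring.
rewrite -mul_tv_row; last by rewrite -scalemxAl -scalemxAr esx !scaler0.
apply: EtrM; first by rewrite -tvZ scalerA; apply: Exes.
have axE : es *m (a *: x) = 0 by rewrite -scalemxAr esx scaler0.
rewrite [a * r]mulrC -scalerA -(@commutator_tv (a *: x) es e y) //; last first.
  by rewrite -scalemxAr yx scaler0.
apply: EtrM; apply: EtrM; first exact: Exes.
- by apply: Etr_tv_col_ker.
- by rewrite -scaleNr; apply: Exes.
by apply: Etr_tv_col_ker; rewrite mulmxN ?ce ?ye oppr0.
Qed.

Variable mu : 'M[A]_m.
Hypotheses (cmu : c *m mu = 0) (muT : mu^T = - mu) (mu0 : forall i, mu i i = 0).

(** One factor [mu i j] serves to write [mu i j] times [w] as a sum of three vectors that have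
    partners among the columns of [mu]; the other two pay for the partner construction. *)
Lemma Etr_wedge q w a i j : c *m w = 0 ->
  Etr c d (tv ((a * mu i j ^+ 3) *: wedge q d w) q).
Proof.
move=> cw; set s := mu i j.
have muji : mu j i = - s by have /matrixP/(_ i j) := muT; rewrite !mxE.
have cf k : c *m col k mu = 0 by rewrite colE mulmxA cmu mul0mx.
(* The k-th coordinate, corrected to kill [d]; on the kernel of [c] it is still the k-th
   coordinate. *)
pose es k : 'rV[A]_m := delta_mx 0 k - d k 0 *: c.
have esd k : es k *m d = 0.
  rewrite mulmxBl -scalemxAl cd -rowE scalemx1; apply/rowP=> l.
  by rewrite !ord1 !mxE mulr1n subrr.
have esv k y : c *m y = 0 -> es k *m y = (y k 0)%:M.
  move=> cy; rewrite mulmxBl -scalemxAl cy scaler0 subr0 -rowE.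
  by apply/rowP=> l; rewrite !ord1 !mxE mulr1n.
have esf k l : es k *m col l mu = (mu k l)%:M by rewrite esv // mxE.
pose fi := col i mu; pose fj := col j mu.
(* Since [mu i i = 0], these coefficients make the i-th coordinate of [w'] vanish, so [es i] kills
   [w'] and pairs with [fj] to [s]. *)
pose w' := s *: w - w i 0 *: fj + w j 0 *: fi.
have cw' : c *m w' = 0.
  by rewrite mulmxDr mulmxBr -!scalemxAr cw !cf !scaler0 subrr addr0.
have w'i : w' i 0 = 0 by rewrite !mxE mu0 mulr0 addr0 mulrC subrr.
have sw : s *: w = w' + w i 0 *: fj + (- w j 0) *: fi.
  by rewrite /w' scaleNr addrAC addrK subrK.
have wE y1 y2 y3 : wedge q d (y1 + y2 + y3) = wedge q d y1 + wedge q d y2 + wedge q d y3.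
  rewrite /wedge !mulmxDr; move: (q *m y1) (q *m y2) (q *m y3) => a1 a2 a3.
  by rewrite !mxE !scalerDl !scalerDr !opprD addrACA [in LHS](addrACA (_ *: d)).
have wZ b y : wedge q d (b *: y) = b *: wedge q d y.
  by rewrite /wedge -scalemxAr !mxE scalerBr !scalerA [_ * b]mulrC.
rewrite exprSr mulrA -scalerA -wZ sw wE !wZ 2!scalerDr 2!scalerA.
have qw b y : q *m (b *: wedge q d y) = 0 by rewrite -scalemxAr mul_wedge scaler0.
rewrite -mul_tv_col ?qw // -mul_tv_col ?qw //.
apply: EtrM; first apply: EtrM.
- apply: (@Etr_wedge_partner q w' fj (es i) s); rewrite ?cf ?esd ?esf //.
  by rewrite esv // w'i raddf0.
(* The partner [fi] pairs with [es j] to [mu j i = - s]; the sign disappears in the square. *)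
- rewrite -mulrA [s ^+ 2 * _]mulrC mulrA -sqrrN -muji.
  by apply: (@Etr_wedge_partner q fj fi (es j)); rewrite ?cf ?esd ?esf ?mu0 ?raddf0.
rewrite -mulrA [s ^+ 2 * _]mulrC mulrA.
by apply: (@Etr_wedge_partner q fi fj (es i)); rewrite ?cf ?esd ?esf ?mu0 ?raddf0.
Qed.

(** Since [q p = 0] and [q z = t], [t p] is the wedge of [p] and [z]. Splitting both along [d] and
    the kernel of [c] leaves a wedge with [d], covered by [Etr_wedge], and a wedge inside that
    kernel. *)
Lemma Etr_tv_col_unimodular p q z t a i j :
  q *m p = 0 -> q *m z = t%:M ->
  Etr c d (tv ((a * mu i j ^+ 3 * t) *: p) q).
Proof.
move=> qp qz.
pose p0 := (c *m p) 0 0; pose z0 := (c *m z) 0 0.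
pose p' := p - p0 *: d; pose z' := z - z0 *: d.
have ck y : c *m (y - (c *m y) 0 0 *: d) = 0.
  by rewrite mulmxBr -scalemxAr cd scalemx1 [c *m y]mx11_scalar !mxE mulr1n subrr.
have cp' : c *m p' = 0 by apply: ck.
have cz' : c *m z' = 0 by apply: ck.
have tpE : t *: p = wedge q d (p0 *: z' - z0 *: p') + wedge q p' z'.
  have -> : p = p0 *: d + p' by rewrite addrC subrK.
  have qd : q *m d = ((q *m d) 0 0)%:M by apply: mx11_scalar.
  set e := (q *m d) 0 0 in qd.
  have qp' : q *m p' = (- (p0 * e))%:M.
    by rewrite mulmxBr qp -scalemxAr qd scale_scalar_mx sub0r raddfN.
  have qz' : q *m z' = (t - z0 * e)%:M.
    by rewrite mulmxBr qz -scalemxAr qd scale_scalar_mx raddfB.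
  rewrite /wedge mulmxBr -!scalemxAr qp' qz' qd !scale_scalar_mx -raddfB /=.
  rewrite !mxE !mulr1n; apply/colP=> k; rewrite !mxE.
  move: (p k 0 - _) (z k 0 - _) => P Z.
  ring.
rewrite -scalerA tpE scalerDr -mul_tv_col; last by rewrite -scalemxAr mul_wedge scaler0.
apply: EtrM.
  by apply: Etr_wedge; rewrite mulmxBr -!scalemxAr cp' cz' !scaler0 subrr.
apply: Etr_tv_col_ker; rewrite -scalemxAr ?mul_wedge ?scaler0 //.
by rewrite mulmxBr -!scalemxAr cp' cz' !scaler0 subrr scaler0.
Qed.

End Group.
End Transvections.

(** * Duality by transposition *)

Section Dual.
Variables (A : comNzRingType) (m : nat) (c : 'rV[A]_m) (d : 'cV[A]_m).

Lemma tr_tv (x : 'cV[A]_m) q : (tv x q)^T = tv q^T x^T.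
Proof. by rewrite /tv linearD /= trmx1 trmx_mul. Qed.

Lemma Etr_tr M : Etr c d M -> Etr d^T c^T M^T.
Proof.
elim=> [|u M' ud _ IH|w M' cw _ IH]; first by rewrite trmx1; constructor.
  rewrite trmx_mul tr_tv; apply: EtrM => //; apply: Etr_tv_col.
  by rewrite -trmx_mul ud trmx0.
rewrite trmx_mul tr_tv; apply: EtrM => //; apply: Etr_tv_row.
by rewrite -trmx_mul cw trmx0.
Qed.

End Dual.

(** Unimodularity weakened from [1] to [t]: clearing denominators preserves it only up to an element
    of the multiplicative set. *)
Definition unimodular_pair (A : comNzRingType) m (p : 'cV[A]_m) (q : 'rV[A]_m) (t : A) :=
  q *m p = 0 /\ ((exists z, q *m z = t%:M) \/ (exists z, z *m p = t%:M)).

(** The zero diagonals are listed apart from antisymmetry, which does not imply them when 2 is a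
    zero divisor. *)
Record alt_frame (A : comNzRingType) m (c : 'rV[A]_m) (d : 'cV[A]_m)
    (mu nu : 'M[A]_m) : Prop := AltFrame {
  frame_cd : c *m d = 1%:M;
  frame_cmu : c *m mu = 0;
  frame_nud : nu *m d = 0;
  frame_muT : mu^T = - mu;
  frame_nuT : nu^T = - nu;
  frame_mu0 : forall i, mu i i = 0;
  frame_nu0 : forall i, nu i i = 0 }.

(** One scalar serves both cases: a unimodular [q] uses the cube from [mu]; a unimodular [p] reduces
    to it by transposition, which turns [c, d, mu, nu] into [d^T, c^T, nu, mu]. *)
Lemma Etr_tv_unimodular (A : comNzRingType) m c d mu nu (p : 'cV[A]_m) q t a i j k l :
  alt_frame c d mu nu -> unimodular_pair p q t ->
  Etr c d (tv ((a * (mu i j ^+ 3 * nu k l ^+ 3) * t) *: p) q).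
Proof.
case=> cd cmu nud muT nuT mu0 nu0 [qp [[z qz]|[z zp]]].
  rewrite [mu i j ^+ 3 * _]mulrC mulrA.
  by apply: (Etr_tv_col_unimodular cd cmu muT mu0 _ _ _ qp qz).
have dcT : d^T *m c^T = 1%:M by rewrite -trmx_mul cd trmx1.
have dnu : d^T *m nu = 0.
  by rewrite -[nu]trmxK -trmx_mul nuT mulNmx nud oppr0 trmx0.
have pq : p^T *m q^T = 0 by rewrite -trmx_mul qp trmx0.
have pz : p^T *m z^T = t%:M by rewrite -trmx_mul zp tr_scalar_mx.
have := Etr_tv_col_unimodular dcT dnu nuT nu0 (a * mu i j ^+ 3) k l pq pz.
by move=> /Etr_tr; rewrite tr_tv linearZ /= !trmxK -tvZ mulrA.
Qed.

(** * Base change *)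

Section Functoriality.
Variables (A B : comNzRingType) (h : {rmorphism A -> B}) (m : nat).

Lemma map_tv (x : 'cV[A]_m) q : map_mx h (tv x q) = tv (map_mx h x) (map_mx h q).
Proof. by rewrite /tv map_mxD map_mx1 map_mxM. Qed.

Lemma map_mulmx_eq0 k l n (x : 'M[A]_(k, l)) (y : 'M[A]_(l, n)) :
  x *m y = 0 -> map_mx h x *m map_mx h y = 0.
Proof. by rewrite -map_mxM => ->; rewrite map_mx0. Qed.

Lemma Etr_map c d (M : 'M[A]_m) :
  Etr c d M -> Etr (map_mx h c) (map_mx h d) (map_mx h M).
Proof.
elim=> [|u M' ud _ IH|w M' cw _ IH]; first by rewrite map_mx1; constructor.
  by rewrite map_mxM map_tv; apply: Etr_row => //; apply: map_mulmx_eq0.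
by rewrite map_mxM map_tv; apply: Etr_col => //; apply: map_mulmx_eq0.
Qed.

Lemma alt_frame_map c d (mu nu : 'M[A]_m) : alt_frame c d mu nu ->
  alt_frame (map_mx h c) (map_mx h d) (map_mx h mu) (map_mx h nu).
Proof.
case=> cd cmu nud muT nuT mu0 nu0; split.
- by rewrite -map_mxM cd map_mx1.
- exact: map_mulmx_eq0.
- exact: map_mulmx_eq0.
- by rewrite map_trmx muT map_mxN.
- by rewrite map_trmx nuT map_mxN.
- by move=> i; rewrite mxE mu0 rmorph0.
- by move=> i; rewrite mxE nu0 rmorph0.
Qed.

End Functoriality.

(** * Clearing denominators *)

Record is_frac (B B' : comNzRingType) (W : B -> Prop) (g : {rmorphism B -> B'}) : Prop :=
  IsFrac {
    frac1 : W 1;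
    fracM : forall s t, W s -> W t -> W (s * t);
    frac_lift : forall x, exists s a, W s /\ g a = g s * x;
    frac_kill : forall a, g a = 0 -> exists s, W s /\ s * a = 0 }.

Section FracMatrix.
Variables (B B' : comNzRingType) (W : B -> Prop) (g : {rmorphism B -> B'}).
Hypothesis hW : is_frac W g.

Lemma frac_fin (T : finType) (P : T -> B -> Prop) :
  (forall i s t, P i s -> P i (s * t)) -> (forall i, exists s, W s /\ P i s) ->
  exists s, W s /\ forall i, P i s.
Proof.
move=> PM /fin_all_exists [s sP]; exists (\prod_i s i); split.
  by apply: (big_ind W) => [||i _]; [case: hW|case: hW|case: (sP i)].
by move=> i; rewrite (bigD1 i) //=; apply: PM; case: (sP i).
Qed.

Lemma frac_lift_mx k l (x : 'M[B']_(k, l)) :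
  exists s a, W s /\ map_mx g a = g s *: x.
Proof.
have [||s [Ws sP]] := @frac_fin ('I_k * 'I_l)%type
    (fun ij s => exists a, g a = g s * x ij.1 ij.2).
- by move=> ij s t [a ga]; exists (a * t); rewrite !rmorphM ga mulrAC.
- by move=> ij; have [s [a [Ws ga]]] := frac_lift hW (x ij.1 ij.2); exists s; split=> //; exists a.
have [a aP] := fin_all_exists sP.
exists s, (\matrix_(i, j) a (i, j)); split=> //.
by apply/matrixP=> i j; rewrite !mxE aP.
Qed.

Lemma frac_kill_mx k l (a : 'M[B]_(k, l)) :
  map_mx g a = 0 -> exists s, W s /\ s *: a = 0.
Proof.
move=> ga0; have [||s [Ws sP]] := @frac_fin ('I_k * 'I_l)%type
    (fun ij s => s * a ij.1 ij.2 = 0).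
- by move=> ij s t sa; rewrite mulrAC sa mul0r.
- move=> ij; apply: (frac_kill hW).
  by have /matrixP/(_ ij.1 ij.2) := ga0; rewrite !mxE.
by exists s; split=> //; apply/matrixP=> i j; rewrite !mxE (sP (i, j)).
Qed.

(** For a lift [z] of [z'] with denominator [r], [q z] and [s r] agree only after localisation; a
    further factor from [W] makes them agree in [B]. *)
Lemma frac_unimodular_row m s (q : 'rV[B]_m) (q' : 'rV[B']_m) z' :
  W s -> map_mx g q = g s *: q' -> q' *m z' = 1%:M ->
  exists t z, W t /\ q *m z = t%:M.
Proof.
move=> Ws gq qz; have [r [z [Wr gz]]] := frac_lift_mx z'.
have [|t [Wt tP]] := @frac_kill_mx 1 1 (q *m z - (s * r)%:M).
  rewrite map_mxB map_mxM gq gz map_scalar_mx -scalemxAl -scalemxAr qz.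
  by rewrite !scale_scalar_mx mulr1 (rmorphM g) subrr.
exists (t * (s * r)), (t *: z); split; first by do ?apply: (fracM hW).
by move/eqP: tP; rewrite scalerBr subr_eq0 scalemxAr scale_scalar_mx => /eqP.
Qed.

Lemma frac_unimodular_pair m (p' : 'cV[B']_m) q' :
  unimodular_pair p' q' 1 ->
  exists p q s r t, [/\ W s, W r & W t] /\
    [/\ map_mx g p = g s *: p', map_mx g q = g r *: q' & unimodular_pair p q t].
Proof.
case=> qp uni.
have [s [p [Ws gp]]] := frac_lift_mx p'; have [r [q [Wr gq]]] := frac_lift_mx q'.
have [|t [Wt tP]] := @frac_kill_mx 1 1 (q *m p).
  by rewrite map_mxM gp gq -scalemxAl -scalemxAr qp !scaler0.
(* Replacing [p] by [t p] makes its product with [q] vanish in [B] itself. *)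
have Wts : W (t * s) by apply: (fracM hW).
have gtp : map_mx g (t *: p) = g (t * s) *: p'.
  by rewrite map_mxZ gp scalerA rmorphM.
have [u [Wu uP]] : exists u, W u /\
    ((exists z, q *m z = u%:M) \/ (exists z, z *m (t *: p) = u%:M)).
  case: uni => [[z' qz]|[z' zp]].
    have [u [z [Wu qz']]] := frac_unimodular_row Wr gq qz.
    by exists u; split=> //; left; exists z.
  have [||u [z [Wu qz]]] := @frac_unimodular_row _ _ (t *: p)^T p'^T z'^T Wts.
  - by rewrite -map_trmx gtp linearZ.
  - by rewrite -trmx_mul zp trmx1.
  exists u; split=> //; right; exists z^T.
  by rewrite -[t *: p]trmxK -trmx_mul qz tr_scalar_mx.
exists (t *: p), q, (t * s), r, u; split=> //; split=> //.
by split=> //; rewrite -scalemxAr.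
Qed.

End FracMatrix.

Lemma polyMX_addC_eq0 (B : comNzRingType) (p : {poly B}) b :
  p * 'X + b%:P = 0 -> p = 0 /\ b = 0.
Proof.
move=> /polyP E; split.
  by apply/polyP=> i; have := E i.+1; rewrite coefD coefMX coefC !coef0 addr0.
by have := E 0%N; rewrite coefD coefMX coefC coef0 add0r.
Qed.

(** Denominators and annihilators of the finitely many coefficients are multiplied together. They
    stay constant, so that the final dilation factor lies in the base ring. *)
Lemma frac_poly (B B' : comNzRingType) (W : B -> Prop) (g : {rmorphism B -> B'}) :
  is_frac W g -> is_frac (fun b => exists s, W s /\ b = s%:P) (map_poly g).
Proof.
move=> hW; split.
- by exists 1; split=> //; case: hW.
- move=> _ _ [s [Ws ->]] [t [Wt ->]]; exists (s * t); rewrite polyCM; split=> //.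
  exact: (fracM hW).
- elim/poly_ind=> [|p x [_ [a [[s [Ws ->]] sP]]]].
    exists 1, 0; rewrite mulr0 rmorph0; split=> //; exists 1; split=> //; exact: (frac1 hW).
  have [t [b [Wt tP]]] := frac_lift hW x.
  exists (s * t)%:P, (a * t%:P * 'X + (s * b)%:P); split.
    by exists (s * t); split=> //; apply: (fracM hW).
  rewrite rmorphD !(rmorphM (map_poly g)) /= sP !map_polyC map_polyX /= !(rmorphM g) tP.
  by rewrite !polyCM [map_poly g s%:P](map_polyC g); ring.
elim/poly_ind=> [|p x IH].
  by exists 1; rewrite mulr0; split=> //; exists 1; split=> //; exact: (frac1 hW).
rewrite rmorphD rmorphM /= map_polyX map_polyC /= => /polyMX_addC_eq0 [/IH [_ [[s [Ws ->]] sP]]].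
move=> /(frac_kill hW) [t [Wt tP]].
exists (s * t)%:P; split; first by exists (s * t); split=> //; apply: (fracM hW).
have tx : t%:P * x%:P = 0 by rewrite -polyCM tP.
transitivity (t%:P * 'X * (s%:P * p) + s%:P * (t%:P * x%:P)).
  by rewrite polyCM; ring.
by rewrite sP tx !mulr0 addr0.
Qed.

(** * Dilation of the variable *)

Section PolyVariable.
Variable A : comNzRingType.

Definition dil (r : A) : {poly A} -> {poly A} := comp_poly (r *: 'X).
HB.instance Definition _ r := GRing.RMorphism.on (dil r).

Lemma dilC r a : dil r a%:P = a%:P.
Proof. exact: comp_polyC. Qed.

Lemma dilX r : dil r 'X = r *: 'X.
Proof. exact: comp_polyX. Qed.

Lemma dil_comp r s p : dil r (dil s p) = dil (s * r) p.
Proof. by rewrite /dil -comp_polyA comp_polyZ comp_polyX scalerA. Qed.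

Lemma dil_eval0 r p : (dil r p).[0] = p.[0].
Proof. by rewrite /dil horner_comp hornerZ hornerX mulr0. Qed.

Lemma polyX_factor (p : {poly A}) : p.[0] = 0 -> exists p1, p = 'X * p1.
Proof.
elim/poly_ind: p => [_|p a _]; first by exists 0; rewrite mulr0.
rewrite hornerMXaddC mulr0 add0r => ->; exists p.
by rewrite polyC0 addr0 mulrC.
Qed.

Lemma polyX_factor_mx k l (M : 'M[{poly A}]_(k, l)) :
  map_mx (horner_eval 0) M = 0 -> exists M1, M = 'X *: M1.
Proof.
move=> M0; have /fin_all_exists [f fP] (ij : 'I_k * 'I_l) :
    exists p1, M ij.1 ij.2 = 'X * p1.
  apply: polyX_factor; have /matrixP/(_ ij.1 ij.2) := M0.
  by rewrite !mxE.
exists (\matrix_(i, j) f (i, j)); apply/matrixP=> i j.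
by rewrite !mxE -fP.
Qed.

Lemma polyX_mx_eq0 k l (M : 'M[{poly A}]_(k, l)) : 'X *: M = 0 -> M = 0.
Proof.
move=> /matrixP XM; apply/matrixP=> i j; have := XM i j; rewrite !mxE.
by move/polyP=> E; apply/polyP=> n; have := E n.+1; rewrite coefXM !coef0.
Qed.

(** Writing [p = X p1] gives [r p1 = 0]; the dilation turns [X] into [r X], and this [r] kills the
    dilated [p1]. *)
Lemma dil_torsion r (p : {poly A}) : p.[0] = 0 -> r%:P * p = 0 -> dil r p = 0.
Proof.
move=> /polyX_factor [p1 ->] rp.
have -> : dil r ('X * p1) = 'X * dil r (r%:P * p1).
  by rewrite !rmorphM /= dilX dilC -mul_polyC; ring.
have -> : r%:P * p1 = 0; last by rewrite rmorph0 mulr0.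
apply/polyP=> n; have /polyP/(_ n.+1) := rp.
by rewrite mulrCA coefXM !coef0.
Qed.

End PolyVariable.

Lemma map_dil (B B' : comNzRingType) (g : {rmorphism B -> B'}) r (p : {poly B}) :
  map_poly g (dil r p) = dil (g r) (map_poly g p).
Proof. by rewrite /dil map_comp_poly map_polyZ map_polyX. Qed.

(** * Lifting elementary matrices from the localisation *)

Section Dilation.
Variables (B B' : comNzRingType) (W : B -> Prop) (g : {rmorphism B -> B'}).
Hypothesis hW : is_frac W g.
Variables (m : nat) (c : 'rV[B]_m) (d : 'cV[B]_m) (mu nu : 'M[B]_m).
Hypothesis frame : alt_frame c d mu nu.
Variables i j k l : 'I_m.
Hypotheses (Wmu : W (mu i j)) (Wnu : W (nu k l)).

Local Notation Epoly := (Etr (map_mx polyC c) (map_mx polyC d)).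

(* The free factor b makes it possible to dilate two factors by the same amount. *)
Definition liftable (M : 'M[{poly B'}]_m) : Prop :=
  exists r, W r /\ forall b, exists h,
    [/\ Epoly h, map_mx (horner_eval 0) h = 1%:M &
        map_mx (map_poly g) h = map_mx (dil (g (r * b))) M].

Lemma liftable1 : liftable 1%:M.
Proof.
exists 1; split; first exact: (frac1 hW).
by move=> b; exists 1%:M; split; rewrite ?map_mx1 //; constructor.
Qed.

Lemma liftableM M N : liftable M -> liftable N -> liftable (M *m N).
Proof.
move=> [r [Wr rP]] [s [Ws sP]]; exists (r * s); split; first exact: (fracM hW).
move=> b; have [h [Eh h0 hM]] := rP (s * b); have [h' [Eh' h0' hN]] := sP (r * b).
exists (h *m h'); split; first exact: EtrM.
  by rewrite map_mxM h0 h0' mul1mx.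
by rewrite map_mxM hM hN map_mxM !mulrA [s * r]mulrC.
Qed.

(** Dilating [X p q] by [r] produces a factor [r]. Taking [r = e t s1 s2 b] pays for the
    denominators [s1], [s2] of [p] and [q], the defect [t] of unimodularity and the cubes [e], and
    keeps [b] free. *)
Lemma liftable_tv p q : unimodular_pair p q 1 -> liftable (tv ('X *: p) q).
Proof.
move=> /(frac_unimodular_pair (frac_poly hW)) [p' [q' [? [? [? []]]]]].
move=> [[s1 [Ws1 ->]] [s2 [Ws2 ->]] [t [Wt ->]]] [gp gq uni].
pose e := mu i j ^+ 3 * nu k l ^+ 3.
have WX n x : W x -> W (x ^+ n).
  move=> Wx; elim: n => [|n IH]; first exact: (frac1 hW).
  by rewrite exprS; apply: (fracM hW).
exists (e * t * s1 * s2); split; first by do ?apply: (fracM hW) => //; apply: WX.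
move=> b; set r := _ * b.
have duni : unimodular_pair (map_mx (dil r) p') (map_mx (dil r) q') t%:P.
  case: uni => qp uni; split; first by rewrite -map_mxM qp map_mx0.
  case: uni => [[z qz]|[z zp]]; [left|right]; exists (map_mx (dil r) z).
    by rewrite -map_mxM qz map_scalar_mx /= dilC.
  by rewrite -map_mxM zp map_scalar_mx /= dilC.
have := Etr_tv_unimodular (b%:P * 'X) i j k l
  (alt_frame_map (polyC : {rmorphism B -> {poly B}}) frame) duni.
rewrite ![in X in X -> _]mxE -!rmorphXn -rmorphM -/e /=.
set a := _ * _ * _ => Ea; exists (tv (a *: map_mx (dil r) p') (map_mx (dil r) q')).
split=> //.
  have a0 : horner_eval 0 a = 0.
    by rewrite /horner_eval /a !hornerM hornerX !(mulr0, mul0r).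
  by rewrite map_tv map_mxZ /= a0 scale0r /tv mul0mx addr0.
have gdil n1 n2 (x : 'M[{poly B}]_(n1, n2)) : map_mx (map_poly g) (map_mx (dil r) x)
    = map_mx (dil (g r)) (map_mx (map_poly g) x).
  by apply/matrixP=> ? ?; rewrite !mxE map_dil.
rewrite !map_tv !map_mxZ !gdil gp gq !map_mxZ /= -tvZ !scalerA.
congr (tv (_ *: _) _); rewrite !map_polyC /= !dilC dilX -mul_polyC.
by rewrite /a !(rmorphM (map_poly g)) /= !map_polyC map_polyX /= /r !(rmorphM g) !polyCM; ring.
Qed.

(** A first dilation agrees with an elementary [h] after localisation. The difference is killed by
    some [s] in [W] and vanishes at 0, so dilating by [s] removes it by [dil_torsion]. *)
Lemma liftable_dil (Theta : 'M[{poly B}]_m) :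
  map_mx (horner_eval 0) Theta = 1%:M -> liftable (map_mx (map_poly g) Theta) ->
  exists r, W r /\ Epoly (map_mx (dil r) Theta).
Proof.
move=> T0 [r [Wr /(_ 1)]]; rewrite mulr1 => -[h [Eh h0 hT]].
have [|_ [[s [Ws ->]] sD]] := @frac_kill_mx _ _ _ _ (frac_poly hW) _ _ (map_mx (dil r) Theta - h).
  rewrite map_mxB hT; apply/matrixP=> a b; rewrite !mxE.
  by apply/eqP; rewrite subr_eq0; apply/eqP; exact: map_dil.
exists (r * s); split; first exact: (fracM hW).
suff -> : map_mx (dil (r * s)) Theta = map_mx (dil s) h.
  have := Etr_map (dil s : {rmorphism {poly B} -> {poly B}}) Eh.
  have dC n1 n2 (x : 'M[B]_(n1, n2)) : map_mx (dil s) (map_mx polyC x) = map_mx polyC x.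
    by apply/matrixP=> ? ?; rewrite !mxE dilC.
  by rewrite !dC.
apply/matrixP=> a b; rewrite !mxE -dil_comp; apply/eqP; rewrite -subr_eq0 -rmorphB /=.
apply/eqP/dil_torsion; last by have /matrixP/(_ a b) := sD; rewrite !mxE.
have /matrixP/(_ a b) := T0; have /matrixP/(_ a b) := h0.
by rewrite !mxE /horner_eval hornerD hornerN dil_eval0 => -> ->; rewrite subrr.
Qed.

Variable sh : {rmorphism B' -> {poly B'}}.
Hypothesis sh0 : forall x, (sh x).[0] = x.
Hypothesis shc : map_mx sh (map_mx g c) = map_mx polyC (map_mx g c).
Hypothesis shd : map_mx sh (map_mx g d) = map_mx polyC (map_mx g d).

(** [sh] abstracts the substitution of [X + Y] for [X], with [Y] the new polynomial variable; at
    [Y = 0] it is the identity. *)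
Lemma shift_factor n1 n2 (x : 'M[B']_(n1, n2)) :
  exists y, map_mx sh x - map_mx polyC x = 'X *: y.
Proof.
apply: polyX_factor_mx; apply/matrixP=> a b; rewrite !mxE /horner_eval.
by rewrite hornerD hornerN hornerC sh0 subrr.
Qed.

(* Peeling off the first factor of M conjugates the remaining quotient by it,
   hence the statement is proved for all conjugates at once. *)
Lemma liftable_shift M : Etr (map_mx g c) (map_mx g d) M ->
  exists N, M *m N = 1%:M /\ forall G G', G *m G' = 1%:M ->
    liftable (G *m (map_mx sh M *m map_mx polyC N) *m G').
Proof.
have cd : map_mx polyC (map_mx g c) *m map_mx polyC (map_mx g d) = 1%:M.
  by rewrite -!map_mxM (frame_cd frame) !map_mx1.
(* The quotient of [T M'] is the quotient of [M'] conjugated by the shifted [T], times the quotient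
   of [T]; the outer conjugation by [G] is carried along. *)
have step (T T' M' N' : 'M[B']_m) : T *m T' = 1%:M -> M' *m N' = 1%:M ->
    (forall G G', G *m G' = 1%:M ->
      liftable (G *m (map_mx sh M' *m map_mx polyC N') *m G')) ->
    (forall G G', G *m G' = 1%:M ->
      liftable (G *m (map_mx sh T *m map_mx polyC T') *m G')) ->
    exists N, T *m M' *m N = 1%:M /\ forall G G', G *m G' = 1%:M ->
      liftable (G *m (map_mx sh (T *m M') *m map_mx polyC N) *m G').
  move=> TT MN IH LT; exists (N' *m T'); split.
    by rewrite mulmxA -(mulmxA T) MN mulmx1.
  move=> G G' GG.
  have -> : G *m (map_mx sh (T *m M') *m map_mx polyC (N' *m T')) *m G' =
    (G *m map_mx sh T *m (map_mx sh M' *m map_mx polyC N') *m (map_mx sh T' *m G')) *m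
    (G *m (map_mx sh T *m map_mx polyC T') *m G').
    have GG' := mulmx1C GG.
    rewrite !map_mxM !mulmxA; congr (_ *m _ *m _).
    rewrite -[in RHS](mulmxA _ G' G) GG' mulmx1 -[in RHS](mulmxA _ (map_mx sh T')).
    by rewrite -(map_mxM sh T') (mulmx1C TT) map_mx1 mulmx1.
  apply: liftableM; last exact: LT.
  apply: IH; rewrite mulmxA -(mulmxA G) -map_mxM TT map_mx1 mulmx1 //.
elim=> [|u M' ud _ [N' [MN IH]]|w M' cw _ [N' [MN IH]]].
- exists 1%:M; split; first by rewrite mulmx1.
  by move=> G G' GG; rewrite !map_mx1 !mulmx1 GG; apply: liftable1.
- apply: (step _ (tv (- map_mx g d) u) _ _ (tvN ud) MN IH) => G G' GG.
  have [u' uP] := shift_factor u.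
  have u'd : u' *m map_mx polyC (map_mx g d) = 0.
    apply: polyX_mx_eq0; rewrite scalemxAl -uP mulmxBl -{1}shd.
    by rewrite !map_mulmx_eq0 // subrr.
  (* As [sh] fixes [d], the product telescopes to [1 + d (sh u - u)], and the difference is the new
     variable times [u']. *)
  have -> : map_mx sh (tv (map_mx g d) u) *m map_mx polyC (tv (- map_mx g d) u)
     = tv ('X *: map_mx polyC (map_mx g d)) u'.
    rewrite !map_tv map_mxN shd tvZ -uP.
    have -> : tv (- map_mx polyC (map_mx g d)) (map_mx polyC u) =
       tv (map_mx polyC (map_mx g d)) (- map_mx polyC u) by rewrite /tv mulNmx mulmxN.
    by rewrite mul_tv_row // -shd map_mulmx_eq0.
  have -> : G *m tv ('X *: map_mx polyC (map_mx g d)) u' *m G' =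
     tv ('X *: (G *m map_mx polyC (map_mx g d))) (u' *m G').
    by rewrite /tv mulmxDr mulmx1 mulmxDl GG -!scalemxAl -scalemxAr -scalemxAl !mulmxA.
  apply: liftable_tv; split.
    by rewrite mulmxA -(mulmxA u') (mulmx1C GG) mulmx1.
  (* [c d = 1] makes [d] unimodular; conjugation by [G] turns the witness [c] into [c G']. *)
  right; exists (map_mx polyC (map_mx g c) *m G').
  by rewrite mulmxA -(mulmxA _ G') (mulmx1C GG) mulmx1.
apply: (step _ (tv (- w) (map_mx g c)) _ _ (tvN cw) MN IH) => G G' GG.
have [w' wP] := shift_factor w.
have cw' : map_mx polyC (map_mx g c) *m w' = 0.
  apply: polyX_mx_eq0; rewrite scalemxAr -wP mulmxBr -{1}shc.
  by rewrite !map_mulmx_eq0 // subrr.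
have -> : map_mx sh (tv w (map_mx g c)) *m map_mx polyC (tv (- w) (map_mx g c))
   = tv ('X *: w') (map_mx polyC (map_mx g c)).
  by rewrite !map_tv map_mxN shc -wP mul_tv_col // mulmxN map_mulmx_eq0 // oppr0.
have -> : G *m tv ('X *: w') (map_mx polyC (map_mx g c)) *m G' =
   tv ('X *: (G *m w')) (map_mx polyC (map_mx g c) *m G').
  by rewrite /tv mulmxDr mulmx1 mulmxDl GG -!scalemxAl -scalemxAr -scalemxAl !mulmxA.
apply: liftable_tv; split.
  by rewrite mulmxA -(mulmxA _ G') (mulmx1C GG) mulmx1.
left; exists (G *m map_mx polyC (map_mx g d)).
by rewrite mulmxA -(mulmxA _ G') (mulmx1C GG) mulmx1.
Qed.

End Dilation.

(** * The group E_phi of an alternating matrix *)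

Section AlternatingBlocks.
Variables (A : comNzRingType) (k : nat).
Implicit Types phi psi : 'M[A]_k.+1.

Lemma alternating_tr phi : alternating phi -> phi^T = - phi.
Proof. by case=> N ->; rewrite linearB /= trmxK opprB. Qed.

Lemma alternating_diag phi i : alternating phi -> phi i i = 0.
Proof. by case=> N ->; rewrite !mxE subrr. Qed.

(** [psi = psi phi psi], and [psi^T = - psi] makes [psi N psi] split it in the way [N] splits
    [phi]. *)
Lemma alternating_inv phi psi : alternating phi -> phi *m psi = 1%:M -> alternating psi.
Proof.
move=> alt inv; have inv' := mulmx1C inv.
have psiT : psi^T = - psi.
  have E : phi *m psi^T = - 1%:M.
    by rewrite -trmx1 -inv' trmx_mul (alternating_tr alt) mulNmx opprK.
  by rewrite -[psi^T]mul1mx -inv' -mulmxA E mulmxN mulmx1.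
case: alt => N phiE; exists (psi *m N *m psi).
rewrite !trmx_mul psiT !mulNmx !mulmxN opprK mulmxA -mulmxBl -mulmxBr -phiE.
by rewrite inv' mul1mx.
Qed.

Lemma alt_frame_blocks phi psi : alternating phi -> phi *m psi = 1%:M ->
  alt_frame (cvec phi) (dvec psi)^T (mublk psi) (nublk phi) /\
  (dvec psi)^T *m cvec phi + mublk psi *m nublk phi = 1%:M.
Proof.
move=> alt inv; have alt' := alternating_inv alt inv.
have phiT i j : phi j i = - phi i j.
  by have /matrixP/(_ i j) := alternating_tr alt; rewrite !mxE.
have psiT i j : psi j i = - psi i j.
  by have /matrixP/(_ i j) := alternating_tr alt'; rewrite !mxE.
have prodE i j : \sum_l phi i (lift ord0 l) * psi (lift ord0 l) j =
    (i == j)%:R - phi i ord0 * psi ord0 j.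
  have /matrixP/(_ i j) := inv; rewrite !mxE big_ord_recl => <-.
  by rewrite addrAC subrr add0r.
split; last first.
  apply/matrixP=> i j; have /matrixP/(_ (lift ord0 i) (lift ord0 j)) := mulmx1C inv.
  rewrite !mxE big_ord_recl big_ord1 !mxE (inj_eq lift_inj) => <-; congr (_ + _).
    by rewrite mulrN -mulNr -psiT.
  by apply: eq_bigr => l _; rewrite !mxE.
split.
- apply/matrixP=> i j; rewrite !ord1 !mxE eqxx.
  have := prodE ord0 ord0; rewrite (alternating_diag _ alt) mul0r subr0 eqxx => <-.
  by apply: eq_bigr => l _; rewrite !mxE mulNr -mulrN -psiT.
- apply/matrixP=> i j; rewrite !ord1 !mxE; have := prodE ord0 (lift ord0 j).
  rewrite (alternating_diag _ alt) mul0r subr0 /= => E; apply/eqP; rewrite -oppr_eq0 -sumrN -[X in _ == X]E; apply/eqP.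
  by apply: eq_bigr => l _; rewrite !mxE mulNr opprK.
- apply/matrixP=> i j; rewrite !ord1 !mxE; have := prodE (lift ord0 i) ord0.
  rewrite (alternating_diag _ alt') mulr0 subr0 /= => E; apply/eqP; rewrite -oppr_eq0 -sumrN -[X in _ == X]E; apply/eqP.
  by apply: eq_bigr => l _; rewrite !mxE -mulrN -psiT.
- by apply/matrixP=> i j; rewrite !mxE psiT.
- by apply/matrixP=> i j; rewrite !mxE phiT.
- by move=> i; rewrite mxE (alternating_diag _ alt').
- by move=> i; rewrite mxE (alternating_diag _ alt).
Qed.

Lemma inEphi_Etr phi psi M : alternating phi -> phi *m psi = 1%:M ->
  inEphi phi psi M <-> Etr (cvec phi) (dvec psi)^T M.
Proof.
move=> alt inv; have [[cd cmu nud _ _ _ _] one] := alt_frame_blocks alt inv.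
have alphaP v : alphaE phi psi v = tv (dvec psi)^T (v *m nublk phi).
  by rewrite /alphaE /tv mulmxA.
have betaP v : betaE phi psi v = tv (mublk psi *m v^T) (cvec phi) by [].
have rowP v : v *m nublk phi *m (dvec psi)^T = 0 by rewrite -mulmxA nud mulmx0.
have colP v : cvec phi *m (mublk psi *m v^T) = 0 by rewrite mulmxA cmu mul0mx.
split.
  elim=> [|g M' [v [->|->]] _ IH|g h M' [v [->|->]] gh _ IH]; first by constructor.
  - by rewrite alphaP; apply: Etr_row.
  - by rewrite betaP; apply: Etr_col.
  (* A left inverse of the generator determines its right inverse [h], which is therefore the
     generator at [- v]. *)
  - have hE : alphaE phi psi (- v) *m alphaE phi psi v = 1%:M.
      rewrite !alphaP mulNmx mul_tv_row ?addNr ?mulNmx ?rowP ?oppr0 //.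
      by rewrite /tv mulmx0 addr0.
    have -> : h = alphaE phi psi (- v) by rewrite -[h]mul1mx -hE -mulmxA gh mulmx1.
    by rewrite alphaP; apply: Etr_row.
  have hE : betaE phi psi (- v) *m betaE phi psi v = 1%:M.
    by rewrite !betaP mul_tv_col // -mulmxDr -linearD addNr linear0 mulmx0 /tv mul0mx addr0.
  have -> : h = betaE phi psi (- v) by rewrite -[h]mul1mx -hE -mulmxA gh mulmx1.
  by rewrite betaP; apply: Etr_col.
elim=> [|u M' ud _ IH|w M' cw _ IH]; first by constructor.
  (* [u = u (d^t c + mu nu) = (u mu) nu] because [u d^t = 0]. The column case is symmetric, with
     [w = mu (nu w)]. *)
  apply: inEphi_gen => //; exists (u *m mublk psi); left.
  rewrite alphaP -mulmxA; congr tv.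
  by rewrite -[u in LHS]mulmx1 -one mulmxDr mulmxA ud mul0mx add0r.
apply: inEphi_gen => //; exists (nublk phi *m w)^T; right.
rewrite betaP trmxK mulmxA; congr tv.
by rewrite -[w in LHS]mul1mx -one mulmxDl -mulmxA cw mulmx0 add0r.
Qed.

End AlternatingBlocks.

(** * Maximal ideals *)

Section Ideals.
Variable R : comNzRingType.

Lemma maximal_ideal_above (I : R -> Prop) : is_ideal I -> ~ I 1 ->
  exists m, maximal_ideal m /\ forall x, I x -> m x.
Proof.
move=> idI I1.
(* J ranges over sets whose union with I is a proper ideal, so that the empty
   chain needs no special treatment. *)
pose P (J : set R) := is_ideal (fun x => J x \/ I x) /\ ~ (J 1 \/ I 1).
have [] := @Zorn_bigcup R P.
  move=> F FP Ftot; split; last first.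
    by case=> // -[J FJ J1]; have [_ []] := FP _ FJ; left.
  case: (idI) => I0 [ID IM]; split; [by right|split].
    have mono J x y : F J -> (J x \/ I x) -> (J y \/ I y) ->
        (bigcup F id) (x + y) \/ I (x + y).
      move=> FJ Jx Jy; have [[_ [JD _]] _] := FP _ FJ.
      by case: (JD _ _ Jx Jy) => ?; [left; exists J|right].
    move=> x y [[J FJ Jx]|Ix] [[K FK Ky]|Iy].
    - have [JK|KJ] := Ftot _ _ FJ FK.
        by apply: (mono K) => //; left=> //; apply: JK.
      by apply: (mono J) => //; left=> //; apply: KJ.
    - by apply: (mono J) => //; [left|right].
    - by apply: (mono K) => //; [right|left].
    - by right; apply: ID.
  move=> a x [[J FJ Jx]|Ix]; last by right; apply: IM.
  have [[_ [_ JM]] _] := FP _ FJ.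
  by case: (JM a x (or_introl Jx)) => ?; [left; exists J|right].
move=> J [[idJ J1] Jmax]; exists (fun x => J x \/ I x); split; last by right.
split=> //; split=> // K idK JK.
have [K1|K1] := EM (K 1); [by right|left=> x Kx].
have [Jx|nJx] := EM (J x); first by left.
exfalso; apply: (Jmax K).
  split; first by move=> y Jy; apply: JK; left.
  by move=> /(_ _ Kx).
have KI y : (K y \/ I y) -> K y by case=> // Iy; apply: JK; right.
case: idK => K0 [KD KM]; split; last by move=> /KI.
split; first by left.
by split=> [y z /KI Ky /KI Kz|a y /KI Ky]; left; [apply: KD|apply: KM].
Qed.

Variable m : R -> Prop.

Lemma maximal_ideal_prime s t : maximal_ideal m -> ~ m s -> ~ m t -> ~ m (s * t).
Proof.
case=> -[m0 [mD mM]] [m1 mmax] ms mt mst.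
have comax x : ~ m x -> exists a y, m y /\ 1 = y + a * x.
  move=> mx; have [||sub|[y [a [my ->]]]] := mmax (fun z => exists y a, m y /\ z = y + a * x).
  - split; first by exists 0, 0; rewrite mul0r addr0.
    split=> [_ _ [y [a [my ->]]] [z [b [mz ->]]]|b _ [y [a [my ->]]]].
      by exists (y + z), (a + b); split; [apply: mD|ring].
    by exists (b * y), (b * a); split; [apply: mM|ring].
  - by move=> y my; exists y, 0; rewrite mul0r addr0.
  - by case: mx; apply: sub; exists 0, 1; rewrite mul1r add0r.
  - by exists a, y.
have [a [y [my ey]]] := comax _ ms; have [b [z [mz ez]]] := comax _ mt.
apply: m1; rewrite -[1]mulr1 {1}ey ez.
have -> : (y + a * s) * (z + b * t) = (z + b * t) * y + (a * s * z + a * b * (s * t)).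
  by ring.
by apply: (mD); [exact: mM|apply: (mD); exact: mM].
Qed.

(* Modulo m the identity is x y, of rank at most one. *)
Lemma rank_one_mod_ideal k (x : 'cV[R]_k) (y : 'rV[R]_k) (M : 'M[R]_k) :
  (1 < k)%N -> is_ideal m -> x *m y + M = 1%:M -> (forall i j, m (M i j)) -> m 1.
Proof.
case: k x y M => [|[|k]] // x y M _ [m0 [mD mM]] E mE.
pose i : 'I_k.+2 := ord0; pose j : 'I_k.+2 := lift ord0 ord0.
have ent a b : x a 0 * y 0 b + M a b = (a == b)%:R.
  by have /matrixP/(_ a b) := E; rewrite !mxE big_ord1.
have Eii := ent i i; have Ejj := ent j j; have Eij := ent i j.
have -> : 1 = M i i + (x i 0 * y 0 i * M j j + (- (x j 0 * y 0 i)) * M i j).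
  have xy : x i 0 * y 0 j = - M i j by apply/eqP; rewrite -addr_eq0 Eij.
  rewrite eqxx in Eii; rewrite eqxx in Ejj.
  transitivity (M i i + x i 0 * y 0 i * (x j 0 * y 0 j + M j j)).
    by rewrite Ejj mulr1 addrC Eii.
  transitivity (M i i + (x i 0 * y 0 i * M j j + x j 0 * y 0 i * (x i 0 * y 0 j))).
    by ring.
  by rewrite xy; ring.
by apply: (mD) => //; apply: (mD); exact: mM.
Qed.

Lemma ideal_sum (T : finType) (F : T -> R) : is_ideal m ->
  (forall i, m (F i)) -> m (\sum_i F i).
Proof. by case=> m0 [mD _] mF; apply: (big_ind m) => // *; apply: mD. Qed.

(** If all entries of [mu], or all of [nu], lay in [m], so would those of [mu nu], and the identity
    would have rank at most one modulo [m]. *)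
Lemma frame_entry_notin k (x : 'cV[R]_k) (y : 'rV[R]_k) (mu nu : 'M[R]_k) :
  (1 < k)%N -> is_ideal m -> ~ m 1 -> x *m y + mu *m nu = 1%:M ->
  (exists i j, ~ m (mu i j)) /\ (exists i j, ~ m (nu i j)).
Proof.
move=> k1 idm m1 E; have [_ [_ mM]] := idm.
split; apply: contrapT => nE; apply: m1; apply: (rank_one_mod_ideal k1 idm E) => i j;
  rewrite mxE; apply: ideal_sum => // l; first rewrite mulrC; apply: mM;
  apply: contrapT => mN; apply: nE; [by exists i, l|by exists l, j].
Qed.

Lemma localization_frac (S : comNzRingType) (f : {rmorphism R -> S}) :
  maximal_ideal m -> is_localization m f -> is_frac (fun s => ~ m s) f.
Proof.
move=> mmax [_ [fx fa]]; split.
- by case: mmax => _ [].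
- by move=> s t; apply: maximal_ideal_prime.
- by move=> x; have [a [s [ms xs]]] := fx x; exists s, a; rewrite mulrC xs.
- exact: fa.
Qed.

End Ideals.

Lemma poly_rmorph_ext (R A : comNzRingType) (f g : {rmorphism {poly R} -> A}) :
  (forall a, f a%:P = g a%:P) -> f 'X = g 'X -> f =1 g.
Proof.
move=> fC fX; elim/poly_ind=> [|p a IH]; first by rewrite !rmorph0.
by rewrite !rmorphD !rmorphM IH fX fC.
Qed.

(** * Patching *)

Section Evaluation.
Variables (R A : comNzRingType) (k : {rmorphism R -> A}).

(** The substitutions in [theta] are expressed through this map, so that comparing two of them
    reduces to constants and [X] by [poly_rmorph_ext]. *)
Definition evp (x : A) : {poly R} -> A := horner_eval x \o map_poly k.
HB.instance Definition _ x := GRing.RMorphism.on (evp x).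

Lemma evpC x a : evp x a%:P = k a.
Proof. by rewrite /evp /= map_polyC /horner_eval hornerC. Qed.

Lemma evpX x : evp x 'X = x.
Proof. by rewrite /evp /= map_polyX /horner_eval hornerX. Qed.

End Evaluation.

(** * The Quillen ideal of [theta] *)

Section LocalGlobal.
Variables (R : comNzRingType) (k : nat).

Definition polyCC (A : comNzRingType) : {rmorphism A -> {poly {poly A}}} := polyC \o polyC.

Lemma evp_comp (A : comNzRingType) (h : {rmorphism {poly {poly R}} -> A})
    (e : {rmorphism R -> A}) x :
  (forall a, h a%:P%:P = e a) -> h \o evp (polyCC R) x =1 evp e (h x).
Proof.
move=> hC; apply: poly_rmorph_ext => [a|] /=; last by rewrite !evpX.
by rewrite !evpC /= hC.
Qed.

Lemma map_evp_comp (A : comNzRingType) (h : {rmorphism {poly {poly R}} -> A})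
    (e : {rmorphism R -> A}) x n1 n2 (M : 'M[{poly R}]_(n1, n2)) :
  (forall a, h a%:P%:P = e a) ->
  map_mx h (map_mx (evp (polyCC R) x) M) = map_mx (evp e (h x)) M.
Proof. by move=> hC; apply/matrixP=> i j; rewrite !mxE -(evp_comp x hC). Qed.

Lemma map_polyCC (A : comNzRingType) (h : {rmorphism {poly {poly R}} -> A})
    (e : {rmorphism R -> A}) n1 n2 (M : 'M[R]_(n1, n2)) :
  (forall a, h a%:P%:P = e a) ->
  map_mx h (map_mx polyC (map_mx polyC M)) = map_mx e M.
Proof. by move=> hC; apply/matrixP=> i j; rewrite !mxE hC. Qed.

Lemma map_polyCC_nested n1 n2 (M : 'M[R]_(n1, n2)) :
  map_mx (polyCC R) M = map_mx polyC (map_mx polyC M).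
Proof. by apply/matrixP=> i j; rewrite !mxE. Qed.

Variables (c : 'rV[R]_k) (d : 'cV[R]_k).
Variables theta theta' : 'M[{poly R}]_k.
Hypothesis thetaK : theta *m theta' = 1%:M.

Local Notation E2 := (Etr (map_mx polyC (map_mx polyC c)) (map_mx polyC (map_mx polyC d))).
Local Notation evC := (evp (polyCC R)).
Local Notation X := ('X%:P : {poly {poly R}}).
Local Notation Y := ('X : {poly {poly R}}).

Definition shift_quot x y := map_mx (evC x) theta *m map_mx (evC y) theta'.
Definition patch_ideal (s : R) := E2 (shift_quot (X + s%:P *: Y) X).

(** The condition at the two variables is generic: sending [X] to [x] and [Y] to [y] preserves
    elementary matrices and fixes [c] and [d]. *)
Lemma patch_ideal_subst s x y : patch_ideal s -> E2 (shift_quot (x + s%:P *: y) x).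
Proof.
move=> Js; pose h : {rmorphism {poly {poly R}} -> {poly {poly R}}} := evp (evC x) y.
have hC a : h a%:P%:P = polyCC R a by exact: etrans (evpC _ _ _) (evpC _ _ _).
have hX : h X = x by exact: etrans (evpC _ _ _) (evpX _ _).
have hY : h Y = y by exact: evpX.
have := Etr_map h Js; rewrite !(map_polyCC _ hC) !map_polyCC_nested map_mxM.
rewrite !(map_evp_comp _ _ hC) hX rmorphD /= hX -mul_polyC rmorphM /=.
by rewrite [evp _ _ s%:P%:P]hC hY /= mul_polyC.
Qed.

(** Sums: move from [X] to [X + s Y], then on by [t Y], and multiply the two quotients. Multiples:
    substitute [a Y] for [Y]. *)
Lemma patch_ideal_is_ideal : is_ideal patch_ideal.
Proof.
split; last split.
- rewrite /patch_ideal /shift_quot polyC0 scale0r addr0 -map_mxM thetaK map_mx1.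
  by constructor.
- move=> s t Js Jt; rewrite /patch_ideal.
  have -> : shift_quot (X + (s + t)%:P *: Y) X =
    shift_quot (X + s%:P *: Y + t%:P *: Y) (X + s%:P *: Y) *m
    shift_quot (X + s%:P *: Y) X.
    rewrite /shift_quot mulmxA -(mulmxA _ _ (map_mx _ theta)) -map_mxM.
    by rewrite (mulmx1C thetaK) map_mx1 mulmx1 polyCD scalerDl addrA.
  by apply: EtrM; apply: patch_ideal_subst.
move=> a s Js; rewrite /patch_ideal mulrC polyCM -scalerA.
exact: patch_ideal_subst.
Qed.

(** Sending [X] to 0 and [Y] to [X] leaves [theta] times the inverse of its value at 0. *)
Lemma patch_ideal_one : map_mx (fun p => p.[0]) theta = 1%:M -> patch_ideal 1 ->
  Etr (map_mx polyC c) (map_mx polyC d) theta.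
Proof.
move=> th0 J1.
pose C1 : {rmorphism R -> {poly R}} := polyC.
pose h : {rmorphism {poly {poly R}} -> {poly R}} := evp (evp C1 0) 'X.
have hC a : h a%:P%:P = C1 a by exact: etrans (evpC _ _ _) (evpC _ _ _).
have hX : h X = 0 by exact: etrans (evpC _ _ _) (evpX _ _).
have hY : h Y = 'X by exact: evpX.
have hXY : h (X + 1%:P *: Y) = 'X by rewrite polyC1 scale1r rmorphD hX hY add0r.
have := Etr_map h J1; rewrite !(map_polyCC _ hC) map_mxM !(map_evp_comp _ _ hC).
rewrite hXY hX.
have -> : map_mx (evp C1 'X) theta = theta.
  apply/matrixP=> i j; rewrite !mxE.
  by apply: (@poly_rmorph_ext _ _ (evp C1 'X) idfun) => [a|] /=; rewrite ?evpC ?evpX.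
have th0' : map_mx (evp C1 0) theta = 1%:M.
  rewrite -(map_mx1 C1) -th0; apply/matrixP=> i j; rewrite !mxE.
  apply: (@poly_rmorph_ext _ _ (evp C1 0) (C1 \o horner_eval 0)) => [a|] /=.
    by rewrite evpC /horner_eval hornerC.
  by rewrite evpX /horner_eval hornerX polyC0.
have : map_mx (evp C1 0) theta *m map_mx (evp C1 0) theta' = 1%:M.
  by rewrite -map_mxM thetaK map_mx1.
by rewrite th0' mul1mx => ->; rewrite mulmx1.
Qed.

(** The lifting results are applied to [R[X]] and [S[X]] with constant denominators outside [m]; the
    dilated variable is [Y]. *)
Lemma patch_ideal_local (mu nu : 'M[R]_k) (m : R -> Prop) (S : comNzRingType)
    (f : {rmorphism R -> S}) :
  (1 < k)%N -> alt_frame c d mu nu -> d *m c + mu *m nu = 1%:M ->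
  maximal_ideal m -> is_localization m f ->
  Etr (map_mx (map_poly f) (map_mx polyC c)) (map_mx (map_poly f) (map_mx polyC d))
    (map_mx (map_poly f) theta) ->
  exists s, ~ m s /\ patch_ideal s.
Proof.
move=> k1 frame one mmax floc Eth.
have hW := frac_poly (localization_frac mmax floc).
have [[i [j mij]] [i' [j' nij]]] := frame_entry_notin k1 mmax.1 mmax.2.1 one.
pose C1 : {rmorphism R -> {poly R}} := polyC.
have frame1 := alt_frame_map C1 frame.
pose sh : {rmorphism {poly S} -> {poly {poly S}}} := evp (polyCC S) ('X + 'X%:P).
pose shR : {rmorphism {poly R} -> {poly {poly R}}} := evp (polyCC R) ('X + 'X%:P).
have sh0 x : (sh x).[0] = x.
  apply: (@poly_rmorph_ext _ _ (horner_eval 0 \o sh) idfun) => [a|] /=.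
    by rewrite evpC /horner_eval hornerC.
  by rewrite evpX /horner_eval hornerD hornerX hornerC add0r.
have shR0 x : (shR x).[0] = x.
  apply: (@poly_rmorph_ext _ _ (horner_eval 0 \o shR) idfun) => [a|] /=.
    by rewrite evpC /horner_eval hornerC.
  by rewrite evpX /horner_eval hornerD hornerX hornerC add0r.
have shf n1 n2 (M : 'M[R]_(n1, n2)) : map_mx sh (map_mx (map_poly f) (map_mx polyC M)) =
    map_mx polyC (map_mx (map_poly f) (map_mx polyC M)).
  by apply/matrixP=> a b; rewrite !mxE map_polyC /= evpC.
have Wmu : exists s, ~ m s /\ map_mx C1 mu i j = s%:P by exists (mu i j); rewrite mxE.
have Wnu : exists s, ~ m s /\ map_mx C1 nu i' j' = s%:P by exists (nu i' j'); rewrite mxE.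
have [N [thN lift]] := liftable_shift hW frame1 Wmu Wnu sh0 (shf _ _ c) (shf _ _ d) Eth.
(* Uniqueness of inverses makes the local quotient the image of the global [Theta] below. *)
have NE : N = map_mx (map_poly f) theta'.
  have K : map_mx (map_poly f) theta' *m map_mx (map_poly f) theta = 1%:M.
    by rewrite -map_mxM (mulmx1C thetaK) map_mx1.
  by rewrite -[N]mul1mx -K -mulmxA thN mulmx1.
pose Theta := map_mx shR theta *m map_mx polyC theta'.
have T0 : map_mx (horner_eval 0) Theta = 1%:M.
  rewrite map_mxM -thetaK; congr (_ *m _); apply/matrixP=> a b.
    by rewrite !mxE; apply: shR0.
  by rewrite !mxE; apply: hornerC.
have FT : map_mx (map_poly (map_poly f)) Theta =
    map_mx sh (map_mx (map_poly f) theta) *m map_mx polyC N.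
  rewrite map_mxM NE; congr (_ *m _); apply/matrixP=> a b; rewrite !mxE.
    apply: (@poly_rmorph_ext _ _ (map_poly (map_poly f) \o shR) (sh \o map_poly f)) => [e|] /=.
      by rewrite !map_polyC /= !evpC /= !map_polyC /= map_polyC.
    by rewrite map_polyX !evpX rmorphD /= map_polyX map_polyC /= map_polyX.
  exact: map_polyC.
have := lift 1%:M 1%:M (mulmx1 _); rewrite mul1mx mulmx1 -FT.
(* The dilation factor is a constant polynomial, so it comes from some [s] in [R] outside [m]. *)
move=> /(liftable_dil hW T0) [_ [[s [ms ->]] Es]]; exists s; split=> //.
rewrite /patch_ideal /shift_quot; move: Es; rewrite map_mxM.
have dC a : dil s%:P a%:P%:P = polyCC R a by rewrite dilC.
have -> : map_mx (dil s%:P) (map_mx shR theta) = map_mx (evC (X + s%:P *: Y)) theta.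
  by rewrite (map_evp_comp _ _ dC) rmorphD /= dilX dilC addrC.
have -> // : map_mx (dil s%:P) (map_mx polyC theta') = map_mx (evC X) theta'.
apply/matrixP=> a b; rewrite !mxE dilC.
by apply: (@poly_rmorph_ext _ _ polyC (evC X)) => [e|] /=; rewrite ?evpC ?evpX.
Qed.

End LocalGlobal.

(* phi has size (2n-1)+1 = 2n; theta has size 2n-1; psi = phi^{-1}. *)
Theorem theorem4p6 (R : comNzRingType) (n : nat) (hn : (2 <= n)%N)
  (phi psi : 'M[R]_((n.*2).-1.+1))
  (halt : alternating phi) (hpf : pfaffian phi = 1)
  (hpsi : phi *m psi = 1%:M)
  (theta : 'M[{poly R}]_((n.*2).-1))
  (hdet : \det theta = 1)
  (h0 : map_mx (fun p => p.[0]) theta = 1%:M)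
  (hloc : forall m : R -> Prop, maximal_ideal m ->
     exists (S : comNzRingType) (f : {rmorphism R -> S}),
       is_localization m f /\
       inEphi (map_mx (fun a => (f a)%:P) phi) (map_mx (fun a => (f a)%:P) psi)
           (map_mx (map_poly f) theta)) :
  inEphi (map_mx polyC phi) (map_mx polyC psi) theta.
Proof.
have size_gt1 : (1 < (n.*2).-1)%N by case: n hn {phi psi halt hpf hpsi theta hdet h0 hloc} => [|[|n]].
have map_alt (A : comNzRingType) (h : {rmorphism R -> A}) : alternating (map_mx h phi).
  by case: halt => N ->; exists (map_mx h N); rewrite map_mxB map_trmx.
have map_inv (A : comNzRingType) (h : {rmorphism R -> A}) :
    map_mx h phi *m map_mx h psi = 1%:M by rewrite -map_mxM hpsi map_mx1.
have cE (A : comNzRingType) (h : {rmorphism R -> A}) :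
    cvec (map_mx h phi) = map_mx h (cvec phi).
  by apply/rowP=> i; rewrite !mxE rmorphN.
have dE (A : comNzRingType) (h : {rmorphism R -> A}) :
    (dvec (map_mx h psi))^T = map_mx h (dvec psi)^T.
  by apply/colP=> i; rewrite !mxE.
have thetaK : theta *m \adj theta = 1%:M by rewrite mul_mx_adj hdet.
have [frame one] := alt_frame_blocks halt hpsi.
pose C1 : {rmorphism R -> {poly R}} := polyC.
apply/(inEphi_Etr _ (map_alt _ C1) (map_inv _ C1)); rewrite cE dE.
(* Were 1 outside the ideal, some maximal [m] would contain the ideal, against the element outside
   [m] found locally. *)
apply: (patch_ideal_one thetaK h0); apply: contrapT => J1.
have [m [mmax Jm]] := maximal_ideal_above (patch_ideal_is_ideal _ _ thetaK) J1.
have [S [f [floc]]] := hloc m mmax.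
pose Cf : {rmorphism R -> {poly S}} := polyC \o f.
move=> /(inEphi_Etr _ (map_alt _ Cf) (map_inv _ Cf)); rewrite cE dE.
have CfE n1 n2 (M : 'M[R]_(n1, n2)) : map_mx Cf M = map_mx (map_poly f) (map_mx polyC M).
  by apply/matrixP=> i j; rewrite !mxE map_polyC.
rewrite !CfE => /(patch_ideal_local thetaK size_gt1 frame one mmax floc) [s [ms Js]].
exact/ms/Jm.
Qed.
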